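(* Let $G$ be a graph with $\chi(G) \geq 2$ and let $t$ be the unique integer for which $2^t < \chi(G) \le 2^{t+1}$. If there is a forest $F$ of $G$ (a set of edges of $G$ containing no cycle) with $\chi(G - F) \le 2^t$, then there is an integer $\ell < 2^{|F|-1}$, depending only on $G$, such that $\mathrm{ex}(\{M(G)\},n) = 2^n(1-2^{-t}) + \ell$ for all sufficiently large $n$.
   Context: A matroid of dimension $m$ is a set $M \subseteq \mathbb{F}_2^m \setminus \{0\}$. A subset of $M \subseteq \mathbb{F}_2^m$ that is the image of $N \subseteq \mathbb{F}_2^k$ under an injective linear map $\mathbb{F}_2^k \to \mathbb{F}_2^m$ is an $N$-restriction of $M$; $M$ is $N$-free if it has no $N$-restriction. $\mathrm{ex}(\{N\},n)$ is the maximum size of an $n$-dimensional $N$-free matroid. For a simple graph $G = (V,E)$, $M(G) \subseteq \mathbb{F}_2^V$ is the matroid consisting of the columns of the $V \times E$ incidence matrix of $G$ over $\mathbb{F}_2$. $\chi(G)$ is the chromatic number of $G$, and $G - F$ is the graph obtained from $G$ by deleting the edges in $F$; $|F|$ is the number of edges of $F$. *)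

(* Defs.v *)
From HB Require Import structures.
From mathcomp Require Import all_boot all_order all_algebra.
From mathcomp Require Import boolp.

Set Implicit Arguments.
Unset Strict Implicit.
Unset Printing Implicit Defensive.

Import GRing.Theory.

Record sgraph := SGraph {
  vertex :> finType;
  adj : rel vertex;
  adj_sym : symmetric adj;
  adj_irrefl : irreflexive adj }.

(* An edge is the two-element set of its ends. *)
Definition edges (G : sgraph) : {set {set G}} :=
  [set [set p.1; p.2] | p : G * G & adj p.1 p.2].

Section DeleteEdges.
Variables (G : sgraph) (F : {set {set G}}).

Definition del_rel : rel G :=
  [rel x y | adj x y && ([set x; y] \notin F)].

Lemma del_rel_sym : symmetric del_rel.
Proof. by move=> x y; rewrite /del_rel /= adj_sym setUC. Qed.

Lemma del_rel_irrefl : irreflexive del_rel.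
Proof. by move=> x; rewrite /del_rel /= adj_irrefl. Qed.

Definition del_edges : sgraph := SGraph del_rel_sym del_rel_irrefl.

End DeleteEdges.

Definition colorable (G : sgraph) (k : nat) : bool :=
  [exists c : {ffun G -> 'I_k},
    [forall x, forall y, adj x y ==> (c x != c y)]].

Lemma colorable_ex (G : sgraph) : exists k, colorable G k.
Proof.
exists #|G|; apply/existsP; exists [ffun x => enum_rank x].
apply/'forall_forallP => x y; apply/implyP => xy; rewrite !ffunE.
by apply: contraL xy => /eqP/enum_rank_inj->; rewrite adj_irrefl.
Qed.

Definition chromatic_number (G : sgraph) : nat := ex_minn (colorable_ex G).

(* A cycle is given by its cyclic sequence of at least three distinct
   vertices. *)
Definition forest (G : sgraph) (F : {set {set G}}) : Prop :=
  F \subset edges G /\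
  forall c : seq G, 2 < size c -> ~ ucycle [rel x y | [set x; y] \in F] c.

Definition matroid (m : nat) (M : {set 'cV['F_2]_m}) : bool := 0%R \notin M.

Definition has_restriction (k m : nat)
    (N : {set 'cV['F_2]_k}) (M : {set 'cV['F_2]_m}) : Prop :=
  exists f : {linear 'cV['F_2]_k -> 'cV['F_2]_m},
    injective f /\ f @: N \subset M.

Definition restriction_free (k m : nat)
    (N : {set 'cV['F_2]_k}) (M : {set 'cV['F_2]_m}) : Prop :=
  ~ has_restriction N M.

(* The maximum over an empty family is 0; this only matters for N = set0,
   since the empty matroid is N-free for every other N. *)
Definition ex_number (k : nat) (N : {set 'cV['F_2]_k}) (n : nat) : nat :=
  \max_(M : {set 'cV['F_2]_n} | matroid M && `[< restriction_free N M >]) #|M|.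

(* Rows and columns are indexed by vertices and edges through enum_val. *)
Definition incidence_matrix (G : sgraph) : 'M['F_2]_(#|G|, #|edges G|) :=
  (\matrix_(i, j) ((enum_val i : G) \in (enum_val j : {set G}))%:R)%R.

Definition graphic_matroid (G : sgraph) : {set 'cV['F_2]_#|G|} :=
  [set col j (incidence_matrix G) | j : 'I_#|edges G|].

(* Main.v *)
(** The engine is Hilbert's cube lemma: over F_2 a cube is an affine subspace, so
a dense set contains large affine subspaces. Iterating it gives a geometric
Erdos-Stone theorem, in which the deleted subspace W of the Bose-Burton geometry
(C + W) \ W can be chosen inside any prescribed large subspace.

For stability, let M have density at least 1 - 2^-t and contain no such geometry
with dim C = t + 1. If M :&: (M + x) were of density above 1 - 2^(1-t) for a
dense set of x in M, a cube x + U of such x would exist, Erdos-Stone applied to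
M :&: (M + x) inside U would give a geometry with dim C = t, and adjoining x to C
is a contradiction. So the complement of M is almost closed under addition, and
hence close to a subspace W of codimension t.

Colouring G - F with 2^t colours, |F| independent elements of M inside W would
give an M(G)-restriction, because the incidence vectors of a forest are
independent. So M has fewer than 2^(|F|-1) elements inside W. Cutting M with a
hyperplane that contains these elements but not W shows that the excess
ex(n) - 2^n (1 - 2^-t) is eventually nonincreasing, hence eventually constant. *)

Require Import Defs.
From HB Require Import structures.
From mathcomp Require Import all_boot all_order all_algebra.
From mathcomp Require Import finfield boolp zify lra ring.

Set Implicit Arguments.
Unset Strict Implicit.
Unset Printing Implicit Defensive.

Import Order.TTheory GRing.Theory Num.Theory.

Local Notation vec n := 'cV['F_2]_n.

(** * Linear algebra *)

Section LinearAlgebra.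
Variables (K : fieldType) (vT wT : vectType K).
Implicit Types (U V W : {vspace vT}) (X : seq vT).

Lemma exists_subv_dim U k : (k <= \dim U)%N ->
  exists2 W : {vspace vT}, (W <= U)%VS & \dim W = k.
Proof.
move=> kU; have := basis_free (vbasisP U).
rewrite -{1}(cat_take_drop k (vbasis U)) => /catl_free freeX.
exists <<take k (vbasis U)>>%VS; last by rewrite (eqP freeX) size_takel ?size_tuple.
by apply/span_subvP => x /mem_take/vbasis_mem.
Qed.

Lemma exists_subv_between U W k : (U <= W)%VS -> (\dim U <= k <= \dim W)%N ->
  exists V : {vspace vT}, [/\ (U <= V)%VS, (V <= W)%VS & \dim V = k].
Proof.
move=> UW /andP[Uk kW]; have dimW := dimv_cap_compl W U.
rewrite (capv_idPr UW) in dimW.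
have [|V VW dimV] := @exists_subv_dim (W :\: U)%VS (k - \dim U); first by lia.
have UV0 : (U :&: V)%VS = 0%VS.
  apply/eqP; rewrite -subv0; apply: subv_trans (capvS (subvv U) VW) _.
  by rewrite capvC capv_diff.
exists (U + V)%VS; rewrite addvSl subv_add UW (subv_trans VW (diffvSl _ _)).
by split=> //; rewrite dimv_disjoint_sum // dimV subnKC.
Qed.

Lemma exists_hyperplane U W : (U <= W)%VS -> (\dim U < \dim W)%N ->
  exists H : {vspace vT},
    [/\ (U <= H)%VS, (W + H)%VS = fullv & \dim H = (\dim {:vT}).-1].
Proof.
move=> UW dimUW.
have [|V [UV VW dimV]] := exists_subv_between (k := (\dim W).-1) UW.
  by rewrite leq_pred andbT -ltnS (ltn_predK dimUW).
have VWC0 : (V :&: W^C)%VS = 0%VS.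
  by apply/eqP; rewrite -subv0 -(capv_compl W) capvS.
exists (V + W^C)%VS; split.
- exact: subv_trans UV (addvSl _ _).
- by rewrite addvA (addv_idPl VW) addv_complf.
rewrite dimv_disjoint_sum // dimv_compl dimV.
by have := dimvS (subvf W); lia.
Qed.

Lemma exists_basis_subseq X : exists2 s, subseq s X & basis_of <<X>> s.
Proof.
elim: X => [|x X [s sX /andP[/eqP spanX free_s]]].
  by exists [::]; rewrite ?sub0seq // /basis_of eqxx nil_free.
have [xs|xNs] := boolP (x \in <<s>>%VS).
  exists s; first exact: subseq_trans sX (subseq_cons _ _).
  rewrite /basis_of free_s andbT span_cons -spanX eq_sym; apply/eqP/addv_idPr.
  by rewrite -memvE.
exists (x :: s); first by rewrite /= eqxx.
by rewrite /basis_of free_cons xNs free_s !span_cons spanX eqxx.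
Qed.

Lemma dim_addv_line U x : x \notin U -> \dim (U + <[x]>) = (\dim U).+1.
Proof.
move=> xU; have x0 : x != 0%R by apply: contraNneq xU => ->; apply: mem0v.
rewrite dimv_disjoint_sum ?dim_vline ?x0 ?addn1 //.
apply/eqP; rewrite -subv0; apply/subvP => y; rewrite memv_cap memv0.
case/andP=> yU /vlineP[a yE]; rewrite yE scaler_eq0 (negbTE x0) orbF.
apply: contraNT xU => a0; rewrite -(scalerK a0 x); apply: memvZ.
by rewrite -yE.
Qed.

Lemma exists_linear_bijection (X : seq vT) (Y : seq wT) (W : {vspace wT}) :
  \dim W = \dim {:vT} -> free X -> free Y -> size Y = size X -> {subset Y <= W} ->
  exists g : 'Hom(vT, wT), [/\ lker g == 0%VS, limg g = W & map g X = Y].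
Proof.
move=> dimW freeX freeY sizeYX YW.
pose X' := X ++ vbasis (<<X>>^C)%VS; pose Y' := Y ++ vbasis (W :\: <<Y>>)%VS.
have basisX' : basis_of fullv X'.
  rewrite -(addv_complf <<X>>%VS); apply: cat_basis; last exact: vbasisP.
    exact/directv_addP/capv_compl.
  by rewrite /basis_of eqxx.
have basisY' : basis_of W Y'.
  have /addv_idPl defW : (<<Y>> <= W)%VS by apply/span_subvP.
  rewrite -[W in basis_of W]defW -addv_diff addvC; apply: cat_basis; last exact: vbasisP.
    by apply/directv_addP; rewrite capvC capv_diff.
  by rewrite /basis_of eqxx.
have sizeX' := size_basis (X := in_tuple X') basisX'.
have sizeY' := size_basis (X := in_tuple Y') basisY'.
have [f fX'] := linear_of_free X' Y'.
have {}fX' : map (linfun f) X' = Y'.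
  rewrite -(fX' (basis_free basisX')) -?sizeX' -?sizeY' //.
  by apply: eq_map => x; rewrite lfunE.
have imgW : limg (linfun f) = W.
  by rewrite -(span_basis basisX') limg_span fX' (span_basis basisY').
exists (linfun f); split=> //.
  rewrite -dimv_eq0 -[lker _]capfv; have := limg_ker_dim (linfun f) fullv.
  by rewrite imgW dimW; lia.
by move: fX'; rewrite map_cat => /eqP; rewrite eqseq_cat ?size_map // => /andP[/eqP].
Qed.

End LinearAlgebra.

Section CharacteristicTwo.
Variable vT : vectType 'F_2.
Implicit Types (x y : vT) (U : {vspace vT}).
Local Open Scope ring_scope.

Lemma F2E (a : 'F_2) : a = (a != 0)%:R.
Proof. by case: a => [[|[|//]]] ?; apply: val_inj. Qed.

Lemma addrr_F2 x : x + x = 0.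
Proof. by rewrite -mulr2n -scaler_nat (pcharf0 (pchar_Fp (isT : prime 2))) scale0r. Qed.

Lemma oppr_F2 x : - x = x.
Proof. by apply/esym/eqP; rewrite -addr_eq0 addrr_F2. Qed.

Lemma addrK_F2 x y : y + x + x = y.
Proof. by rewrite -addrA addrr_F2 addr0. Qed.

Lemma mem_addv_line U x y : (y \in (U + <[x]>)%VS) = (y \in U) || (y + x \in U).
Proof.
apply/memv_addP/orP => [[u uU [_ /vlineP[a ->] ->]]|].
  rewrite [a]F2E; case: (a != 0) => /=; last by rewrite scale0r addr0; left.
  by rewrite scale1r addrK_F2; right.
case=> yU; first by exists y => //; exists 0; rewrite ?mem0v ?addr0.
by exists (y + x) => //; exists x; rewrite ?memv_line ?addrK_F2.
Qed.

Lemma free_F2 (I : finType) (F : {set I}) (f : I -> vT) :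
  (forall T : {set I}, T \subset F -> \sum_(i in T) f i = 0 -> T = set0) ->
  free [seq f i | i <- enum F].
Proof.
move=> sum_neq0.
suff: free (map_tuple f (enum_tuple F)) by [].
apply/freeP => a sum_a; pose T := [set enum_val i | i : 'I_#|F| & a i != 0].
have T0 : T = set0.
  apply: sum_neq0; first by apply/subsetP => _ /imsetP[i _ ->]; apply: enum_valP.
  rewrite big_imset /= => [|i j _ _]; last exact: enum_val_inj.
  rewrite big_mkcond -[RHS]sum_a; apply: eq_bigr => i _.
  rewrite [a i]F2E inE (nth_map (enum_val i)) -?enum_val_nth -?cardE //.
  by case: (a i != 0); rewrite ?scale1r ?scale0r.
move=> i; apply/eqP/negPn/negP => ai0.
have : enum_val i \in T by apply/imsetP; exists i; rewrite ?inE.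
by rewrite T0 inE.
Qed.

End CharacteristicTwo.

(** * Subsets of binary vector spaces *)

Lemma exists_ge_average (R : realDomainType) (I : finType) (A : {set I}) (f : I -> R) c :
  A != set0 -> (c * #|A|%:R <= \sum_(i in A) f i)%R ->
  exists2 i, i \in A & (c <= f i)%R.
Proof.
case/set0Pn=> i0 i0A; apply: contraPP => no_i; apply/negP.
rewrite -ltNge mulr_natr -sumr_const; apply: ltr_sum.
  by apply/hasP; exists i0; rewrite ?mem_index_enum.
by move=> i iA; rewrite ltNge; apply/negP => ci; apply: no_i; exists i.
Qed.

Lemma exp2_gt0 (R : numDomainType) m : (0 < 2 ^+ m :> R)%R.
Proof. by rewrite exprn_gt0 ?ltr0n. Qed.

Lemma exp2_neq0 (R : numDomainType) m : (2 ^+ m != 0 :> R)%R.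
Proof. by rewrite gt_eqF ?exp2_gt0. Qed.

Lemma exp2V_gt0 (R : numFieldType) m : (0 < 2 ^- m :> R)%R.
Proof. by rewrite invr_gt0 exp2_gt0. Qed.

Lemma exp2V_le1 (R : numFieldType) m : (2 ^- m <= 1 :> R)%R.
Proof. by rewrite invf_le1 ?exp2_gt0 ?exprn_ege1 ?ler1n. Qed.

Lemma mul2_exp2V (R : numFieldType) m : (2 * 2 ^- m.+1 = 2 ^- m :> R)%R.
Proof. by rewrite exprS invfM mulrA divff ?mul1r ?pnatr_eq0. Qed.

Section VectorSets.
Variable n : nat.
Implicit Types (x y : vec n) (A B : {set vec n}) (U W : {vspace vec n}).
Local Open Scope ring_scope.

Definition setv U : {set vec n} := [set x in U].

Lemma in_setv U x : (x \in setv U) = (x \in U).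
Proof. exact: in_set. Qed.

Lemma setvS U W : (setv U \subset setv W) = (U <= W)%VS.
Proof. by apply/subsetP/subvP => UW x; have := UW x; rewrite !in_setv. Qed.

Lemma setvf : setv fullv = setT.
Proof. by apply/setP => x; rewrite in_setv memvf inE. Qed.

Lemma setvI U W : setv (U :&: W) = setv U :&: setv W.
Proof. by apply/setP => x; rewrite !inE memv_cap. Qed.

Lemma card_setv U : #|setv U| = (2 ^ \dim U)%N.
Proof. by rewrite cardsE card_vspace card_Fp. Qed.

Lemma card_vec : #|{: vec n}| = (2 ^ n)%N.
Proof. by rewrite card_mx card_Fp // muln1. Qed.

Lemma dimv_vec : \dim {:vec n} = n.
Proof. by rewrite dimvf /dim /= muln1. Qed.

Definition shift A x : {set vec n} := [set y | y + x \in A].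

Lemma in_shift A x y : (y \in shift A x) = (y + x \in A).
Proof. exact: in_set. Qed.

Lemma shiftK A x : shift (shift A x) x = A.
Proof. by apply/setP => y; rewrite !in_shift addrK_F2. Qed.

Lemma shiftI A B x : shift (A :&: B) x = shift A x :&: shift B x.
Proof. by apply/setP => y; rewrite !inE. Qed.

Lemma shift_setv U x : x \in U -> shift (setv U) x = setv U.
Proof. by move=> xU; apply/setP => y; rewrite !inE rpredDr. Qed.

Lemma card_shift A x : #|shift A x| = #|A|.
Proof.
rewrite -(card_imset _ (addIr x)); apply: eq_card => y; apply/imsetP/idP.
  by case=> z; rewrite in_shift => zA ->.
by move=> yA; exists (y + x); rewrite ?in_shift addrK_F2.
Qed.

Lemma sum_card_overlap U A B :
  (\sum_(x in U) #|A :&: shift B x :&: setv U| = #|A :&: setv U| * #|B :&: setv U|)%N.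
Proof.
under eq_bigr do rewrite -sum1_card big_mkcond.
rewrite exchange_big -sum_nat_const [RHS]big_mkcond /=; apply: eq_bigr => y _.
have [yAU|] := boolP (y \in A :&: setv U); last first.
  rewrite in_setI => yAU; rewrite big1 // => x _.
  by rewrite in_setI [y \in A :&: _]in_setI andbAC (negbTE yAU).
have [yA yU] : y \in A /\ y \in U by move: yAU; rewrite !inE => /andP[].
rewrite -(card_shift (B :&: _) y) -sum1_card big_mkcond [RHS]big_mkcond /=.
apply: eq_bigr => x _; rewrite !inE yA yU andbT /= addrC.
by rewrite rpredDr //; case: (x \in U); rewrite ?andbT ?andbF.
Qed.

End VectorSets.

Section Density.
Variables (R : realFieldType) (n : nat).
Implicit Types (x : vec n) (A B : {set vec n}) (U W : {vspace vec n}).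
Local Open Scope ring_scope.

Definition density U A : R := #|A :&: setv U|%:R / 2 ^+ \dim U.

Lemma card_density U A : #|A :&: setv U|%:R = density U A * 2 ^+ \dim U.
Proof. by rewrite mulfVK ?exp2_neq0. Qed.

Lemma densityfE A : density fullv A = #|A|%:R / 2 ^+ n.
Proof. by rewrite /density dimv_vec setvf setIT. Qed.

Lemma card_densityf A : #|A|%:R = density fullv A * 2 ^+ n.
Proof. by rewrite densityfE mulfVK ?exp2_neq0. Qed.

Lemma density_setv W : density fullv (setv W) = 2 ^+ \dim W / 2 ^+ n.
Proof. by rewrite densityfE card_setv natrX. Qed.

Lemma density_ge0 U A : 0 <= density U A.
Proof. by rewrite divr_ge0 ?(ltW (exp2_gt0 _ _)). Qed.

Lemma densityS U A B : A \subset B -> density U A <= density U B.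
Proof.
by move=> AB; rewrite ler_pM2r ?invr_gt0 ?exp2_gt0 // ler_nat subset_leq_card ?setSI.
Qed.

Lemma densityUI U A B :
  density U (A :|: B) + density U (A :&: B) = density U A + density U B.
Proof. by rewrite -!mulrDl -!natrD setIUl setIIl cardsUI. Qed.

Lemma densityID U A B : density U (A :&: B) + density U (A :\: B) = density U A.
Proof. by rewrite -mulrDl -natrD setIAC setIDAC cardsID. Qed.

Lemma densityC U A : density U (~: A) = 1 - density U A.
Proof.
apply/eqP; rewrite eq_sym subr_eq -mulrDl -natrD addnC ![_ :&: setv U]setIC -setDE.
by rewrite cardsID card_setv natrX divff ?exp2_neq0.
Qed.

Lemma density_shift U A x : x \in U -> density U (shift A x) = density U A.
Proof.
by move=> xU; rewrite /density -[in LHS](shift_setv xU) -shiftI card_shift.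
Qed.

Lemma density_addv_line U A x : x \notin U ->
  density (U + <[x]>) A = (density U A + density U (shift A x)) / 2.
Proof.
move=> xU; have splitA : A :&: setv (U + <[x]>) =
    (A :&: setv U) :|: shift (shift A x :&: setv U) x.
  by apply/setP => y; rewrite !inE mem_addv_line addrK_F2 -andb_orr.
rewrite /density splitA dim_addv_line // cardsU card_shift (_ : _ :&: shift _ x = set0).
  by rewrite cards0 subn0 natrD exprSr invfM mulrA mulrDl.
apply/setP => y; rewrite !inE; apply/negP => /andP[/andP[_ yU] /andP[_ yxU]].
by move: xU; rewrite -(rpredDl _ yU) yxU.
Qed.

Lemma exists_dense_shift W A : exists x, density fullv A <= density W (shift A x).
Proof.
have [||x _ ?] :=
    @exists_ge_average _ _ setT (fun x => density W (shift A x)) (density fullv A).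
- by apply/set0Pn; exists 0; rewrite inE.
- rewrite densityfE cardsT card_vec natrX mulfVK ?exp2_neq0 // -mulr_suml.
  rewrite -natr_sum ler_pdivlMr ?exp2_gt0 // -natrX -card_setv -natrM ler_nat mulnC.
  have := sum_card_overlap fullv (setv W) A; rewrite setvf !setIT => <-.
  apply: eq_leq; apply: eq_big => [x|x _]; first by rewrite memvf inE.
  by rewrite setIT setIC.
- by exists x.
Qed.

Lemma exists_dense_overlap U A : (0 < \dim U)%N ->
  exists h, [/\ h \in U, h != 0
    & density U A ^+ 2 <= density U (A :&: shift A h) + 2 ^- \dim U].
Proof.
move=> dimU; set d := density U A; set N : R := 2 ^+ \dim U.
have cardU0 : #|setv U| = #|setv U :\ 0|.+1 by rewrite (cardsD1 0) in_setv mem0v.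
have N_ge2 : 2 <= N by rewrite /N -(prednK dimU) exprS ler_peMr ?exprn_ege1 ?ler1n.
have sum_overlap : \sum_(h in U) density U (A :&: shift A h) = N * d ^+ 2.
  rewrite -mulr_suml -natr_sum sum_card_overlap natrM !card_density -/d -/N.
  by field; rewrite exp2_neq0.
have [||h hU avg] := @exists_ge_average _ _ (setv U :\ 0)
    (fun h => density U (A :&: shift A h)) (d ^+ 2 - N^-1).
- by rewrite -card_gt0 -ltnS -cardU0 card_setv -{1}(expn0 2) ltn_exp2l.
- have -> : #|setv U :\ 0|%:R = N - 1 by rewrite /N -natrX -card_setv cardU0 mulrSr addrK.
  have : density U (A :&: shift A 0) <= d by apply/densityS/subsetIl.
  move: sum_overlap; rewrite (bigD1 0) ?mem0v //= (eq_bigl (mem (setv U :\ 0))).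
    move: (\sum_(_ in _) _) => S.
    have NV : N * N^-1 = 1 by rewrite divff // gt_eqF //; lra.
    have : N^-1 <= 2^-1 by rewrite lef_pV2 ?posrE //; lra.
    by have := sqr_ge0 (d - 2^-1); rewrite expr2; nra.
  by move=> h; rewrite !inE andbC.
by move: hU; rewrite !inE => /andP[h0 hU]; exists h; rewrite hU h0; split=> //; lra.
Qed.

End Density.

Arguments density {R n} U A.
Arguments exists_dense_shift R {n} W A.
Arguments exists_dense_overlap R {n} U A.

(** * Affine cubes and Bose-Burton geometries *)

(* Hilbert's cube lemma: over F_2 a cube is an affine subspace. A large overlap
   A :&: (A + h) is invariant under h, so it is equally dense in a complement of h,
   and a cube found there extends along h. *)
Lemma affine_cube (R : archiRealFieldType) k (eps : R) : (0 < eps)%R ->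
  exists D, forall n (U : {vspace vec n}) (A : {set vec n}),
    D <= \dim U -> (eps <= density U A)%R ->
    exists x (W : {vspace vec n}),
      [/\ (W <= U)%VS, \dim W = k & forall w, w \in W -> (x + w)%R \in A].
Proof.
elim: k eps => [|k IHk] eps eps_gt0.
  exists 0 => n U A _ densA.
  have /set0Pn[x /setIP[xA _]] : A :&: setv U != set0.
    by apply: contraTneq densA => A0; rewrite /density A0 cards0 mul0r -ltNge.
  exists x, 0%VS; rewrite sub0v dimv0; split=> // w.
  by rewrite memv0 => /eqP->; rewrite addr0.
pose eps' : R := (eps ^+ 2 / 2)%R.
have eps'_gt0 : (0 < eps')%R by rewrite divr_gt0 ?exprn_gt0.
have [D cubeD] := IHk _ eps'_gt0.
exists (D.+1 + Num.bound eps'^-1) => n U A dimU densA.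
have [|h [hU h0 densT]] := exists_dense_overlap R U A; first by lia.
set T := A :&: _ in densT.
pose U' := (U :\: <[h]>)%VS.
have defU : (U' + <[h]>)%VS = U.
  by rewrite addv_diff; apply/addv_idPl; rewrite -memvE.
have hU' : h \notin U'.
  apply: contraNN h0 => hU'; rewrite -memv0 -(capv_diff U <[h]>).
  by rewrite memv_cap hU' memv_line.
have dimU' : \dim U = (\dim U').+1 by rewrite -defU dim_addv_line.
have densT' : density U' T = density U T :> R.
  have shiftT : shift T h = T by rewrite shiftI shiftK setIC.
  by rewrite -defU density_addv_line // shiftT; lra.
have [||x [W [WU dimW xWT]]] := cubeD _ U' T; first by lia.
  have : (2 ^- \dim U < eps')%R.
    rewrite -[eps']invrK ltf_pV2 ?posrE ?exp2_gt0 ?invr_gt0 //.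
    exact: upper_nthrootP (leq_trans (leq_addl _ _) dimU).
  have := ler_pM (ltW eps_gt0) (ltW eps_gt0) densA densA.
  by rewrite densT' /eps' -!expr2; lra.
exists x, (W + <[h]>)%VS; split.
- by rewrite -defU addvS.
- by rewrite dim_addv_line ?dimW //; apply: contra hU'; apply/subvP.
move=> w; rewrite mem_addv_line => /orP[] /xWT; rewrite !inE => /andP[//].
by rewrite addrA addrK_F2.
Qed.

Section Sumsets.
Variable n : nat.
Implicit Types (A B : {set vec n}) (x y : vec n).

Definition sumset A B : {set vec n} := [set (a + b)%R | a in A, b in B].

Lemma card_sumset A B : #|sumset A B| <= #|A| * #|B|.
Proof. by rewrite /sumset curry_imset2X (leq_trans (leq_imset_card _ _)) ?cardsX. Qed.

Lemma density_sumset (R : realFieldType) (C : {vspace vec n}) B :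
  (density fullv (sumset (setv C) B) <= (2 : R) ^+ \dim C * density fullv B)%R.
Proof.
rewrite !densityfE mulrA ler_pM2r ?invr_gt0 ?exp2_gt0 //.
by rewrite -natrX -natrM ler_nat -card_setv card_sumset.
Qed.

Lemma notin_sumset A B x y : x \notin sumset A B -> y \in A -> (x + y)%R \notin B.
Proof.
move=> xAB yA; apply: contra xAB => xyB.
by apply/imset2P; exists y (x + y)%R; rewrite // addrC addrK_F2.
Qed.

End Sumsets.

(* M contains the Bose-Burton geometry (C + W) \ W. *)
Definition bose_burton n (M : {set vec n}) (C W : {vspace vec n}) : Prop :=
  forall c w, c \in C -> w \in W -> c != 0%R -> (c + w)%R \in M.

Lemma bose_burton_subset n (M M' : {set vec n}) (C W : {vspace vec n}) :
  M \subset M' -> bose_burton M C W -> bose_burton M' C W.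
Proof. by move=> /subsetP MM' bbM c w cC wW c0; apply/MM'/bbM. Qed.

Lemma bose_burton_capv n (M : {set vec n}) (C W : {vspace vec n}) :
  matroid M -> bose_burton M C W -> (C :&: W)%VS = 0%VS.
Proof.
move=> M0 bbM; apply/eqP; rewrite -subv0; apply/subvP => x.
rewrite memv_cap memv0 => /andP[xC xW]; apply: contraNT M0 => x0.
by rewrite -(addrr_F2 x) bbM.
Qed.

Lemma bose_burton_addv_line n (M : {set vec n}) (C W W' : {vspace vec n}) x :
  bose_burton M C W -> (W' <= W)%VS ->
  (forall c w, c \in C -> w \in W' -> (x + c + w)%R \in M) ->
  bose_burton M (C + <[x]>) W'.
Proof.
move=> bbM /subvP W'W xM c w; rewrite mem_addv_line => /orP[cC|cxC] wW' c0.
  by apply: bbM => //; apply: W'W.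
by have := xM _ _ cxC wW'; rewrite [(x + _)%R]addrC addrK_F2.
Qed.

Lemma geometric_erdos_stone (R : archiRealFieldType) i k (eps : R) : (0 < eps)%R ->
  exists D, forall n (M : {set vec n}) (U : {vspace vec n}),
    matroid M -> D <= \dim U -> (1 - 2 * 2 ^- i + eps <= density fullv M)%R ->
    exists C W : {vspace vec n},
      [/\ (W <= U)%VS, \dim C = i, \dim W = k & bose_burton M C W].
Proof.
move=> eps_gt0; elim: i k => [|i IHi] k.
  exists k => n M U _ /exists_subv_dim[W WU dimW] _; exists 0%VS, W.
  by rewrite dimv0; split=> // c w; rewrite memv0 => ->.
have [D cubeD] := affine_cube k eps_gt0; have [D' esD'] := IHi D.
exists D' => n M U M0 dimU densM.
have twoi_gt0 := exp2_gt0 R i; rewrite mul2_exp2V in densM.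
have [|C [W [WU dimC dimW bbM]]] := esD' n M U M0 dimU.
  by have := exp2V_gt0 R i; lra.
pose Y := ~: sumset (setv C) (~: M).
have YM y c : y \in Y -> c \in C -> (y + c)%R \in M.
  by rewrite -in_setv inE => /notin_sumset yCM /yCM; rewrite inE negbK.
have densY : (eps <= density fullv Y)%R.
  rewrite /Y densityC.
  have : (2 ^+ i * density fullv (~: M) <= 2 ^+ i * (2 ^- i - eps))%R.
    by rewrite ler_pM2l // densityC; lra.
  have := density_sumset R C (~: M); rewrite mulrBr divff ?exp2_neq0 // dimC.
  have : (eps <= 2 ^+ i * eps)%R by rewrite ler_peMl ?exprn_ege1 ?ler1n // ltW.
  by lra.
have [x densYx] := exists_dense_shift R W Y.
have [||y [W' [W'W dimW' yY]]] := cubeD n W (shift Y x).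
- by rewrite dimW.
- exact: le_trans densYx.
have yxY w : w \in W' -> (y + x + w)%R \in Y.
  by move/yY; rewrite in_shift addrAC.
have yxC : (y + x)%R \notin C.
  apply/negP => /(YM _ _ (yxY _ (mem0v W'))).
  by rewrite addr0 addrr_F2 (negbTE M0).
exists (C + <[(y + x)%R]>)%VS, W'; split=> //.
- exact: subv_trans WU.
- by rewrite dim_addv_line ?dimC.
apply: bose_burton_addv_line bbM W'W _ => c w cC wW'.
by rewrite addrAC; apply: YM => //; apply: yxY.
Qed.

(** * Stability *)

Definition bose_burton_free n (M : {set vec n}) (i k : nat) : Prop :=
  forall C W : {vspace vec n}, \dim C = i -> \dim W = k -> ~ bose_burton M C W.

(* For a cube x + U of large overlaps, a geometry of rank t in M :&: (M + x) with
   W inside U is extended by x to one of rank t + 1 in M. *)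
Lemma few_dense_overlaps (R : archiRealFieldType) t k (eps : R) : (0 < eps)%R ->
  exists D, forall n (M : {set vec n}),
    D <= n -> matroid M -> bose_burton_free M t.+1 k ->
    (density fullv
       [set x in M | (1 - 2 * 2 ^- t + eps <= density fullv (M :&: shift M x))%R]
     < eps)%R.
Proof.
move=> eps_gt0; have [D esD] := geometric_erdos_stone t k eps_gt0.
have [D' cubeD'] := affine_cube D eps_gt0; exists D' => n M nD' M0 freeM.
set E := [set x in M | _]; rewrite ltNge; apply/negP => densE.
have [|x [U [_ dimU xE]]] := cubeD' n fullv E _ densE; first by rewrite dimv_vec.
have xM u : u \in U -> (x + u)%R \in M by move/xE; rewrite inE => /andP[].
have := xE _ (mem0v U); rewrite addr0 inE => /andP[x_M densMx].
have M0x : matroid (M :&: shift M x) by rewrite /matroid inE (negbTE M0).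
have [|C [W [WU dimC dimW bbMx]]] := esD n _ U M0x _ densMx; first by rewrite dimU.
have xC : x \notin C.
  apply/negP => xC; have x0 : x != 0%R by apply: contraTneq x_M => ->.
  have := bbMx _ _ xC (mem0v W) x0.
  by rewrite addr0 !inE addrr_F2 (negbTE M0) andbF.
apply: (freeM (C + <[x]>)%VS W) => //; first by rewrite dim_addv_line ?dimC.
have bbM := bose_burton_subset (subsetIl _ _) bbMx.
apply: (bose_burton_addv_line bbM (subvv W)) => c w cC wW.
have [->|c0] := eqVneq c 0%R.
  by rewrite addr0; apply: xM; apply: (subvP WU).
have := bbMx _ _ cC wW c0; rewrite !inE => /andP[_].
by rewrite -[(x + c + w)%R]addrA [(x + _)%R]addrC.
Qed.

Section AlmostClosedSets.
Variable n : nat.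
Implicit Types (K S : {set vec n}) (x y z : vec n).

Lemma addr_closed_vspace S : 0%R \in S -> {in S &, forall x y, (x + y)%R \in S} ->
  exists W : {vspace vec n}, setv W = S.
Proof.
move=> S0 SD; exists <<enum S>>%VS; apply/setP => x; rewrite in_setv; apply/idP/idP.
  rewrite -(in_tupleE (enum S)) => /coord_span->.
  apply: (big_ind (fun x => x \in S)) => // i _.
  rewrite [coord _ i x]F2E; case: (_ != 0%R); rewrite ?scale0r // scale1r.
  by rewrite -mem_enum mem_nth // ltn_ord.
by move=> xS; apply: memv_span; rewrite mem_enum.
Qed.

Lemma small_doubling_vspace S : 2 * #|sumset S S| < 3 * #|S| ->
  exists W : {vspace vec n}, setv W = sumset S S.
Proof.
move=> smallS; have overlap z : z \in sumset S S -> #|S| < 2 * #|S :&: shift S z|.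
  case/imset2P=> a b aS bS ->.
  have -> : S :&: shift S (a + b)%R = shift (shift S a :&: shift S b) a.
    by apply/setP => y; rewrite !inE addrK_F2 addrA.
  have := cardsUI (shift S a) (shift S b); rewrite !card_shift.
  have : #|shift S a :|: shift S b| <= #|sumset S S|.
    apply/subset_leq_card/subsetP => y; rewrite !inE => /orP[] yS; apply/imset2P.
      by exists (y + a)%R a; rewrite ?addrK_F2.
    by exists (y + b)%R b; rewrite ?addrK_F2.
  by lia.
apply: addr_closed_vspace => [|y z /overlap Sy /overlap Sz].
  have /card_gt0P[a aS] : 0 < #|S| by lia.
  by apply/imset2P; exists a a; rewrite ?addrr_F2.
have /card_gt0P[x] : 0 < #|(S :&: shift S y) :&: (S :&: shift S z)|.
  have := cardsUI (S :&: shift S y) (S :&: shift S z).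
  have : #|(S :&: shift S y) :|: (S :&: shift S z)| <= #|S|.
    by apply/subset_leq_card; rewrite subUset !subsetIl.
  by lia.
rewrite !inE => /andP[/andP[_ xyS] /andP[_ xzS]].
apply/imset2P; exists (x + y)%R (x + z)%R => //.
by rewrite addrACA addrr_F2 add0r.
Qed.

Lemma card_setD_shiftD K x y :
  #|K :\: shift K (x + y)%R| <= #|K :\: shift K x| + #|K :\: shift K y|.
Proof.
rewrite -(card_shift (K :\: shift K y) x).
apply: leq_trans (leq_card_setU _ _); apply/subset_leq_card/subsetP => v.
by rewrite !inE addrA => /andP[-> ->]; case: (_ \in K).
Qed.

Definition nonclosed_pairs K : {set vec n * vec n} :=
  [set p | [&& p.1 \in K, p.2 \in K & (p.1 + p.2)%R \notin K]].

Lemma card_nonclosed_pairs K :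
  #|nonclosed_pairs K| = \sum_x \sum_y [&& x \in K, y \in K & (x + y)%R \notin K].
Proof.
rewrite pair_bigA -sum1_card big_mkcond; apply: eq_bigr => p _ /=.
by rewrite inE; case: ifP.
Qed.

Lemma sum_setD_shift K : \sum_(x in K) #|K :\: shift K x| = #|nonclosed_pairs K|.
Proof.
rewrite card_nonclosed_pairs big_mkcond; apply: eq_bigr => x _.
case: (x \in K); last by rewrite big1.
rewrite -sum1_card big_mkcond; apply: eq_bigr => y _.
by rewrite !inE andbC addrC; case: (_ && _).
Qed.

Lemma sum_setI_shift K : \sum_(z in ~: K) #|K :&: shift K z| = #|nonclosed_pairs K|.
Proof.
have -> : \sum_(z in ~: K) #|K :&: shift K z| =
    \sum_z \sum_x [&& x \in K, (x + z)%R \in K & z \notin K].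
  rewrite big_mkcond; apply: eq_bigr => z _; rewrite inE; case: (z \in K) => /=.
    by rewrite big1 // => x _; rewrite !andbF.
  rewrite -sum1_card big_mkcond; apply: eq_bigr => x _.
  by rewrite !inE andbT; case: (_ && _).
rewrite card_nonclosed_pairs exchange_big; apply: eq_bigr => x _.
rewrite (reindex_inj (addrI x)); apply: eq_bigr => y _ /=.
by rewrite addrA addrr_F2 add0r.
Qed.

(* Elements of S + S are periods of K up to |K| / 4 points, so there are at most
   4 |K| / 3 of them, too few for S + S not to be closed. *)
Lemma almost_closed_vspace K : 0 < #|K| -> 160 * #|nonclosed_pairs K| <= #|K| ^ 2 ->
  exists W : {vspace vec n},
    3 * #|setv W| <= 4 * #|K| /\ #|K :\: setv W| * #|K| <= 8 * #|nonclosed_pairs K|.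
Proof.
move=> K_gt0 fewK; pose S : {set vec n} := [set z | 8 * #|K :\: shift K z| <= #|K|].
have cardKS : #|K :\: S| * #|K| <= 8 * #|nonclosed_pairs K|.
  rewrite -sum_setD_shift -sum_nat_const big_distrr /= [leqRHS](big_setID S) /=.
  apply: leq_trans (leq_addl _ _); apply: leq_sum => y; rewrite !inE => /andP[+ _].
  by rewrite -ltnNge => /ltnW.
have period z : z \in sumset S S -> 4 * #|K :\: shift K z| <= #|K|.
  case/imset2P=> a b; rewrite !inE => aS bS ->.
  by apply: leq_trans (leq_mul (leqnn 4) (card_setD_shiftD K a b)) _; lia.
have overlap z : z \in sumset S S -> 3 * #|K| <= 4 * #|K :&: shift K z|.
  by move/period; have := cardsID (shift K z) K; lia.
have cardSS : 3 * #|sumset S S| <= 4 * #|K|.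
  rewrite -(leq_pmul2r K_gt0) -[4 * _ * _]mulnA.
  have := sum_card_overlap fullv K K; rewrite setvf !setIT => <-.
  rewrite big_distrr /= [3 * _]mulnC -mulnA -sum_nat_const.
  rewrite big_mkcond [leqRHS]big_mkcond; apply: leq_sum => z _.
  by rewrite memvf setIT; case: ifP => // /overlap.
have S0 : 0%R \in S.
  rewrite inE (_ : _ :\: _ = set0) ?cards0 //.
  by apply/setP => y; rewrite !inE addr0 andNb.
have cardKS20 : 20 * #|K :\: S| <= #|K|.
  by rewrite -(leq_pmul2r K_gt0); move: fewK; rewrite -mulnn; lia.
have cardS : #|K| <= #|S| + #|K :\: S|.
  by rewrite -(cardsID S K) leq_add2r subset_leq_card ?subsetIr.
have smallS : 2 * #|sumset S S| < 3 * #|S| by lia.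
have [W defW] := small_doubling_vspace smallS.
exists W; rewrite defW; split=> //; apply: leq_trans cardKS.
rewrite leq_mul2r subset_leq_card ?orbT // setDS //.
by apply/subsetP => z zS; apply/imset2P; exists z 0%R; rewrite ?addr0.
Qed.

End AlmostClosedSets.

Lemma dim_of_density (R : realFieldType) n (W : {vspace vec n}) t :
  (2 ^- t / 2 < (density fullv (setv W) : R) < 2 ^- t * 2)%R -> \dim W + t = n.
Proof.
have densW : density fullv (setv W) = (2 ^- t * (2 ^+ (\dim W + t) / 2 ^+ n))%R :> R.
  by rewrite density_setv exprD; field; rewrite !exp2_neq0.
rewrite densW !ltr_pM2l ?exp2V_gt0 //.
rewrite ltr_pdivlMr ?exp2_gt0 // ltr_pdivrMl // ltr_pdivrMr ?exp2_gt0 //.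
by rewrite -!exprS -!natrX !ltr_nat !ltn_exp2l //; lia.
Qed.

Lemma card_nonclosed_pairs_setC_le (R : realFieldType) n (M : {set vec n}) t (d : R) :
  (1 - 2 ^- t <= density fullv M :> R)%R ->
  (density fullv
     [set x in M | (1 - 2 * 2 ^- t + d <= density fullv (M :&: shift M x))%R] <= d)%R ->
  (#|nonclosed_pairs (~: M)|%:R <= 2 * d * (2 ^+ n * 2 ^+ n))%R.
Proof.
set E := [set x in M | _] => densM densE.
have overlap z : z \in M ->
    (density fullv (~: M :&: shift (~: M) z) <= (z \in E)%:R + d)%R.
  move=> zM; have -> : shift (~: M) z = ~: shift M z by apply/setP => y; rewrite !inE.
  have := densityUI R fullv M (shift M z); rewrite -setCU densityC density_shift ?memvf //.
  have := density_ge0 R fullv (M :|: shift M z); have := density_ge0 R fullv E.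
  by rewrite inE zM andTb; case: (lerP _ (density fullv (M :&: _))) => /=; lra.
rewrite -sum_setI_shift setCK natr_sum mulrA.
have {overlap} : (\sum_(z in M) (#|~: M :&: shift (~: M) z|%:R : R)
    <= \sum_z ((z \in E)%:R + d) * 2 ^+ n)%R.
  rewrite big_mkcond; apply: ler_sum => z _; case: ifP => [zM|_].
    by rewrite card_densityf ler_pM2r ?exp2_gt0 ?overlap.
  rewrite mulr_ge0 ?(ltW (exp2_gt0 _ _)) ?addr_ge0 ?ler0n //.
  exact: le_trans (density_ge0 _ _ _) densE.
move=> /le_trans->//; rewrite -mulr_suml ler_pM2r ?exp2_gt0 // big_split /=.
rewrite sumr_const -natr_sum -big_mkcond sum1_card card_densityf.
rewrite -[#|xpredT|]/#|{: vec n}| card_vec -[(d *+ _)%R]mulr_natr natrX.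
by rewrite -mulrDl ler_pM2r ?exp2_gt0 //; lra.
Qed.

Lemma almost_closed_vspace_density (R : realFieldType) n (K : {set vec n}) (r : R) :
  (0 < density fullv K :> R)%R -> (160 * r <= density fullv K ^+ 2)%R ->
  (#|nonclosed_pairs K|%:R <= r * (2 ^+ n * 2 ^+ n))%R ->
  exists W : {vspace vec n},
    (3 * density fullv (setv W) <= 4 * density fullv K :> R)%R /\
    (density fullv (K :\: setv W) * density fullv K <= 8 * r)%R.
Proof.
set kappa : R := density fullv K; set N : R := (2 ^+ n)%R => K_gt0 r_le fewK.
have N_gt0 : (0 < N)%R := exp2_gt0 R n.
have NN_gt0 : (0 < N * N)%R by rewrite mulr_gt0.
have [||W []] := @almost_closed_vspace n K.
- by rewrite -(ltr_nat R) card_densityf mulr_gt0.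
- rewrite -(ler_nat R) natrM natrX card_densityf -/N -/kappa exprMn [(N ^+ 2)%R]expr2.
  by have := ler_wpM2r (ltW NN_gt0) r_le; lra.
rewrite -!(ler_nat R) !natrM !card_densityf -/N -/kappa => cardW cardKW.
exists W; split; first by move: cardW; rewrite !mulrA ler_pM2r.
rewrite -(ler_pM2r NN_gt0); set kW := density _ _ in cardKW *.
by move: cardKW; lra.
Qed.

Lemma almost_closed_vspace_codim (R : realFieldType) n (K : {set vec n}) t (d : R) :
  (0 < d)%R -> (1280 * d <= (2 ^- t) ^+ 2)%R ->
  (2 ^- t - d <= (density fullv K : R) <= 2 ^- t)%R ->
  (#|nonclosed_pairs K|%:R <= 2 * d * (2 ^+ n * 2 ^+ n))%R ->
  exists2 W : {vspace vec n},
    \dim W + t = n & (2 ^- t * density fullv (setv W :\: K) <= 33 * d)%R.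
Proof.
set a : R := (2 ^- t)%R; set kappa : R := density fullv K.
move=> d_gt0 d_small /andP[K_ge K_le] fewK.
have a_gt0 : (0 < a)%R := exp2V_gt0 R t; have a_le1 : (a <= 1)%R := exp2V_le1 R t.
have a2_le : (a ^+ 2 <= a)%R by rewrite expr2 ler_piMl // ltW.
have half_ge0 : (0 <= a / 2)%R by lra.
have K_ge_half : (a / 2 <= kappa)%R by lra.
have K_gt0 : (0 < kappa)%R by lra.
have K2_ge : (160 * (2 * d) <= kappa ^+ 2)%R.
  by have := ler_pM half_ge0 half_ge0 K_ge_half K_ge_half; rewrite -!expr2; lra.
have [W [densW densKW]] := almost_closed_vspace_density K_gt0 K2_ge fewK.
rewrite -/kappa in densW densKW.
have := densityID R fullv K (setv W); have := densityID R fullv (setv W) K.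
rewrite -/kappa [setv W :&: K]setIC => splitW splitK.
have {}densKW : (a * density fullv (K :\: setv W) <= 32 * d)%R.
  have KW_ge0 := density_ge0 R fullv (K :\: setv W).
  by have := ler_wpM2r KW_ge0 K_ge_half; lra.
have KW_le : (density fullv (K :\: setv W) <= a / 40)%R.
  by rewrite -(ler_pM2l a_gt0) [leRHS]mulrA -expr2; lra.
have densW_near : (a / 2 < (density fullv (setv W) : R) < a * 2)%R.
  by have := density_ge0 R fullv (setv W :\: K); lra.
have dimW := dim_of_density densW_near; exists W => //.
have densW_eq : density fullv (setv W) = a.
  rewrite density_setv; have -> : (2 ^+ n = 2 ^+ \dim W * 2 ^+ t :> R)%R.
    by rewrite -exprD dimW.
  by rewrite invfM mulrA divff ?mul1r ?exp2_neq0.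
have defect_le : (a * (a - kappa) <= a - kappa)%R by rewrite ler_piMl ?subr_ge0.
have -> : density fullv (setv W :\: K) = (a - kappa + density fullv (K :\: setv W))%R.
  by lra.
by rewrite mulrDr; lra.
Qed.

Lemma stability (R : archiRealFieldType) t k (eps : R) : (0 < eps)%R ->
  exists n0, forall n (M : {set vec n}),
    n0 <= n -> matroid M -> (1 - 2 ^- t <= density fullv M :> R)%R ->
    bose_burton_free M t.+1 k ->
    exists2 W : {vspace vec n},
      \dim W + t = n & (density fullv (M :&: setv W) <= eps)%R.
Proof.
move=> eps_gt0; pose a : R := (2 ^- t)%R.
have a_gt0 : (0 < a)%R := exp2V_gt0 R t; have a_le1 : (a <= 1)%R := exp2V_le1 R t.
pose m := Num.min eps 1%R; pose d : R := (a ^+ 2 * m / 1280)%R.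
have m_gt0 : (0 < m)%R by rewrite lt_min eps_gt0 ltr01.
have [m_le_eps m_le1] : (m <= eps)%R /\ (m <= 1)%R by rewrite !ge_min !lexx orbT.
have d_gt0 : (0 < d)%R by rewrite /d divr_gt0 ?mulr_gt0 ?exprn_gt0 ?ltr0n.
have [n1 overlapM] := few_dense_overlaps t k d_gt0.
have [D esM] := geometric_erdos_stone t.+1 k d_gt0.
exists (n1 + D) => n M nn M0 densM freeM.
have densE := overlapM n M (leq_trans (leq_addr _ _) nn) M0 freeM.
have densM_lt : (density fullv M < 1 - a + d)%R.
  rewrite ltNge; apply/negP => densM'.
  have [||C [W [_ dimC dimW bbM]]] := esM n M fullv M0; last exact: freeM bbM.
    by rewrite dimv_vec (leq_trans (leq_addl _ _) nn).
  by rewrite mul2_exp2V.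
have fewM := card_nonclosed_pairs_setC_le densM (ltW densE).
have d_small : (1280 * d <= a ^+ 2)%R.
  by rewrite /d mulrC divfK ?pnatr_eq0 // ler_piMr // exprn_ge0 // ltW.
have densMC : (a - d <= (density fullv (~: M) : R) <= a)%R.
  by move: densM densM_lt; rewrite densityC -/a; lra.
have [W dimW densW] := almost_closed_vspace_codim d_gt0 d_small densMC fewM.
exists W; rewrite // setIC -[M]setCK -setDE -(ler_pM2l a_gt0).
apply: le_trans densW _; rewrite /d.
have : (a ^+ 2 * m <= a * m)%R by rewrite ler_pM2r // expr2 ler_piMl // ltW.
have : (a * m <= a * eps)%R by rewrite ler_pM2l.
have : (0 < a * eps)%R by rewrite mulr_gt0.
by lra.
Qed.

Lemma exists_coset_subset n (M : {set vec n}) (X V : {vspace vec n}) : (X <= V)%VS ->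
  #|~: (M :|: setv V)| * 2 ^ \dim X + 2 ^ \dim V < 2 ^ n ->
  exists2 b, b \notin V & forall x, x \in X -> (b + x)%R \in M.
Proof.
move=> /subvP XV few; pose B := ~: (M :|: setv V).
have [b] : exists b, b \notin setv V :|: sumset B (setv X).
  apply/existsP; rewrite -negb_forall; apply/negP => /forallP all_bad; move: few.
  apply/negP; rewrite -leqNgt -card_vec -cardsT -!card_setv addnC.
  apply: leq_trans (leq_add (leqnn _) (card_sumset B _)).
  apply: leq_trans (leq_card_setU _ _).
  by apply/subset_leq_card/subsetP => x _; apply: all_bad.
rewrite in_setU in_setv negb_or => /andP[bV bB]; exists b => // x xX.
apply: contraR bB => bxM; apply/imset2P; exists (b + x)%R x; rewrite ?in_setv ?addrK_F2 //.
by rewrite /B !inE negb_or bxM rpredDr // XV.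
Qed.

Lemma exists_bose_burton n t (M : {set vec n}) (U W : {vspace vec n}) :
  (U <= W)%VS -> \dim W + t <= n ->
  2 ^ (t + \dim U).+1 * #|~: (M :|: setv W)| <= 2 ^ n ->
  exists2 C : {vspace vec n}, \dim C = t & bose_burton M C U.
Proof.
move=> UW; elim: t => [|t IHt] dimW few.
  by exists 0%VS; rewrite ?dimv0 // => c w; rewrite memv0 => ->.
have [||C dimC bbM] := IHt; first by rewrite (leq_trans _ dimW) // leq_add2l.
  by apply: leq_trans few; rewrite leq_mul2r leq_exp2l // addSn leqnSn orbT.
have [||b bWC bM] := @exists_coset_subset n M (C + U) (W + C).
- by rewrite addvC addvS.
- have dimCU : \dim (C + U) <= t + \dim U by rewrite -dimC dimv_add_leqif.
  have dimWC : \dim (W + C) < n.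
    by apply: leq_ltn_trans (dimv_add_leqif W C) _; rewrite dimC -addnS.
  have card_le : #|~: (M :|: setv (W + C))| <= #|~: (M :|: setv W)|.
    by apply/subset_leq_card; rewrite setCS setUS // setvS addvSl.
  have := leq_mul card_le (leq_pexp2l (isT : 0 < 2) dimCU).
  have : 2 * 2 ^ \dim (W + C) <= 2 ^ n by rewrite -expnS leq_exp2l.
  have : 0 < 2 ^ n by rewrite expn_gt0.
  by move: few; rewrite addSn !expnS; lia.
exists (C + <[b]>)%VS.
  by rewrite dim_addv_line ?dimC //; apply: contra bWC; apply/subvP/addvSr.
apply: (bose_burton_addv_line bbM (subvv U)) => c w cC wU.
by rewrite -addrA bM // memv_add.
Qed.

(** * Graphic matroids *)

Section Rank.
Variable n : nat.
Implicit Types (A M : {set vec n}) (U W : {vspace vec n}).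

Definition rank A : nat := \dim <<enum A>>.

Lemma size_le_rank A (s : seq (vec n)) : free s -> {subset s <= A} -> size s <= rank A.
Proof.
move=> free_s sA; rewrite -(eqP free_s); apply/dimvS/span_subvP => x /sA xA.
by apply: memv_span; rewrite mem_enum.
Qed.

Lemma exists_free_seq A r : r <= rank A ->
  exists s : seq (vec n), [/\ free s, size s = r & {subset s <= A}].
Proof.
have [s /mem_subseq sA /andP[/eqP span_s free_s]] := exists_basis_subseq (enum A).
move=> r_le; have size_s : r <= size s by rewrite -(eqP free_s) span_s.
exists (take r s); split.
- by move: free_s; rewrite -{1}(cat_take_drop r s) => /catl_free.
- exact: size_takel.
by move=> x /mem_take/sA; rewrite mem_enum.
Qed.

Lemma exists_vspace_rank A W r k : r <= rank (A :&: setv W) -> r <= k <= \dim W ->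
  exists U : {vspace vec n}, [/\ (U <= W)%VS, \dim U = k & r <= rank (A :&: setv U)].
Proof.
move=> r_le r_k; have [s [free_s size_s sAW]] := exists_free_seq r_le.
have sW : (<<s>> <= W)%VS by apply/span_subvP => x /sAW; rewrite !inE => /andP[].
have [|U [sU UW dimU]] := exists_subv_between (k := k) sW.
  by rewrite (eqP free_s) size_s.
exists U; split=> //; rewrite -size_s; apply: size_le_rank => // x xs.
have := sAW _ xs; rewrite !inE => /andP[-> _].
by apply: (subvP sU); apply: memv_span.
Qed.

Lemma card_matroid_lt M : matroid M -> #|M| < 2 ^ rank M.
Proof.
move=> M0; rewrite /rank -card_setv [ltnRHS](cardsD1 0%R) in_setv mem0v add1n ltnS.
apply/subset_leq_card/subsetP => x xM; rewrite !inE; apply/andP; split.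
  by apply: contraTneq xM => ->.
by apply: memv_span; rewrite mem_enum.
Qed.

Lemma matroid_setIl M A : matroid M -> matroid (M :&: A).
Proof. by rewrite /matroid inE negb_and => ->. Qed.

End Rank.

(* Without pendant edges every path is either prolonged or closed to a cycle. *)
Lemma exists_ucycle_of_no_pendant (T : finType) (R : rel T) x0 y0 :
  symmetric R -> irreflexive R -> R x0 y0 ->
  (forall x y, R x y -> exists2 z, R x z & z != y) ->
  exists2 c, 2 < size c & ucycle R c.
Proof.
move=> symR irrR xy0 next; apply: contrapT => acyclic.
have extend x y p : uniq [:: x, y & p] -> path R x (y :: p) ->
    exists z, uniq [:: z, x, y & p] && path R z [:: x, y & p].
  move=> uniq_p path_p; have [z xz zy] : exists2 z, R x z & z != y.
    by case/andP: path_p => /next.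
  have zx : z != x by apply: contraTneq xz => ->; rewrite irrR.
  have path_zp : path R z [:: x, y & p] by rewrite /= symR xz.
  exists z; rewrite path_zp andbT cons_uniq uniq_p andbT !inE !negb_or zx zy /=.
  apply/negP => zp; apply: acyclic.
  case/splitPr: zp uniq_p path_p => p1 p2 {path_zp}.
  rewrite -cat_rcons -!cat_cons cat_uniq cat_path => /andP[uniq_c _] /andP[path_c _].
  exists [:: x, y & rcons p1 z]; first by rewrite /= size_rcons.
  rewrite /ucycle uniq_c andbT /cycle rcons_path path_c /= last_rcons symR; exact: xz.
have long m : exists x y p, [/\ uniq [:: x, y & p], path R x (y :: p) & size p = m].
  elim: m => [|m [x [y [p [uniq_p path_p size_p]]]]].
    have x0y0 : x0 != y0 by apply: contraTneq xy0 => ->; rewrite irrR.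
    by exists x0, y0, [::]; split; rewrite /= ?mem_seq1 ?xy0 ?x0y0.
  have [z /andP[uniq_zp path_zp]] := extend _ _ _ uniq_p path_p.
  by exists z, x, (y :: p); rewrite /= size_p.
have [x [y [p [uniq_p _ size_p]]]] := long #|T|.
have := max_card (mem [:: x, y & p]).
by rewrite (card_uniqP uniq_p) /= size_p => /ltnW; rewrite ltnn.
Qed.

Section Incidence.
Variable G : sgraph.
Implicit Types (u v : G) (e : {set G}) (F T : {set {set G}}).
Local Open Scope ring_scope.

Definition incidence e : vec #|G| := \col_i (enum_val i \in e)%:R.

Lemma graphic_matroidE : graphic_matroid G = incidence @: edges G.
Proof.
have col_incidence j : col j (incidence_matrix G) = incidence (enum_val j).
  by apply/colP => i; rewrite !mxE.
apply/setP => x; apply/imsetP/imsetP => [[j _ ->]|[e eG ->]].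
  by exists (enum_val j); rewrite ?col_incidence ?enum_valP.
by exists (enum_rank_in eG e); rewrite ?col_incidence ?enum_rankK_in.
Qed.

Lemma incidence_pair u v : u != v ->
  incidence [set u; v] = incidence [set u] + incidence [set v].
Proof.
move=> uv; apply/colP => i; rewrite !mxE !inE.
by case: eqVneq => [->|_]; rewrite ?(negbTE uv) ?addr0 ?add0r.
Qed.

Lemma adj_neq u v : adj u v -> u != v.
Proof. by apply: contraTneq => ->; rewrite adj_irrefl. Qed.

Lemma mem_edges u v : adj u v -> [set u; v] \in edges G.
Proof. by move=> uv; apply/imsetP; exists (u, v); rewrite ?inE. Qed.

Lemma edgesP e : e \in edges G -> exists u v, adj u v /\ e = [set u; v].
Proof. by case/imsetP=> -[u v]; rewrite inE; exists u, v. Qed.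

Lemma other_end e u : e \in edges G -> u \in e -> exists2 v, e = [set u; v] & u != v.
Proof.
case/edgesP=> a [b [/adj_neq ab ->]] /set2P[]->; first by exists b.
by exists a; rewrite 1?setUC // eq_sym.
Qed.

Lemma graphic_matroid_adj u v : adj u v ->
  incidence [set u] + incidence [set v] \in graphic_matroid G.
Proof.
move=> uv; rewrite -incidence_pair ?adj_neq // graphic_matroidE.
exact/imset_f/mem_edges.
Qed.

Lemma exists_linear_vertex_map n (c : G -> vec n) (C : {vspace vec n}) :
  (forall v, c v \in C) ->
  exists2 P : 'Hom(vec #|G|, vec n),
    (limg P <= C)%VS & forall v, P (incidence [set v]) = c v.
Proof.
move=> cC; pose A : 'M['F_2]_(n, #|G|) := \matrix_(r, i) c (enum_val i) r 0.
have mulA x : A *m x = \sum_i x i 0 *: c (enum_val i).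
  apply/colP => r; rewrite mxE summxE; apply: eq_bigr => i _.
  by rewrite !mxE mulrC.
exists (linfun (mulmx A)) => [|v].
  apply/subvP => _ /memv_imgP[x _ ->]; rewrite lfunE /= mulA.
  by apply: memv_suml => i _; apply: memvZ.
rewrite lfunE /= mulA (bigD1 (enum_rank v)) //= big1 => [|i iv].
  by rewrite mxE enum_rankK inE eqxx scale1r addr0.
by rewrite mxE inE -(inj_eq enum_rank_inj) enum_valK (negbTE iv) scale0r.
Qed.

Lemma forest0 : forest (set0 : {set {set G}}).
Proof.
split=> [|[|x [|y c]] // _ /andP[/= /andP[+ _] _]]; first exact: sub0set.
by rewrite inE.
Qed.

Lemma forest_subset F T : forest F -> T \subset F -> forest T.
Proof.
move=> [FG acyclicF] TF; split; first exact: subset_trans TF FG.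
move=> c size_c /andP[cycle_c uniq_c]; apply: (acyclicF c size_c); apply/andP.
by split=> //; apply: sub_cycle cycle_c => x y; apply: (subsetP TF).
Qed.

Lemma second_incident_edge T e u : \sum_(e' in T) incidence e' = 0 ->
  e \in T -> u \in e -> exists e', [/\ e' \in T, u \in e' & e' != e].
Proof.
move=> sum0 eT ue; apply: contrapT => only_e.
have /eqP := congr1 (fun x : vec _ => x (enum_rank u) 0) sum0; apply/negP.
rewrite summxE (bigD1 e) //= big1 => [|e' /andP[e'T e'e]].
  by rewrite !mxE enum_rankK ue addr0.
rewrite mxE enum_rankK; case: (boolP (u \in e')) => // ue'.
by case: only_e; exists e'.
Qed.

Lemma forest_sum_incidence_eq0 T : forest T ->
  \sum_(e in T) incidence e = 0 -> T = set0.
Proof.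
move=> [TG acyclicT] sum0; apply/eqP/set0Pn => -[e0 e0T].
pose R := [rel x y : G | [set x; y] \in T].
have [u0 [v0 [_ e0E]]] := edgesP (subsetP TG _ e0T).
have [||||c size_c] := @exists_ucycle_of_no_pendant _ R u0 v0; last exact: acyclicT.
- by move=> x y; rewrite /R /= setUC.
- move=> x; apply/negP => xx; have [y xE] := other_end (subsetP TG _ xx) (set21 x x).
  by have := set22 x y; rewrite -xE setUid inE eq_sym => ->.
- by rewrite /R /= -e0E.
move=> x y xy; have [e [eT xe e_xy]] := second_incident_edge sum0 xy (set21 x y).
have [z ez xz] := other_end (subsetP TG _ eT) xe.
exists z; first by rewrite /R /= -ez.
by apply: contraNneq e_xy => <-; rewrite ez.
Qed.

Lemma forest_free F : forest F -> free [seq incidence e | e <- enum F].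
Proof.
move=> forestF; apply: free_F2 => T TF.
exact: forest_sum_incidence_eq0 (forest_subset forestF TF).
Qed.

Lemma card_forest_le F : forest F -> (#|F| <= #|G|)%N.
Proof.
move/forest_free/eqP; rewrite size_map -cardE => <-.
by rewrite -[leqRHS]dimv_vec dimvS ?subvf.
Qed.

End Incidence.

Lemma colorable_from (G : sgraph) (T : finType) (S : {set T}) (c : G -> T) k :
  (forall v, c v \in S) -> #|S| <= k -> (forall u v : G, adj u v -> c u != c v) ->
  colorable G k.
Proof.
move=> cS card_S proper_c; apply/existsP.
exists [ffun v => widen_ord card_S (enum_rank_in (cS v) (c v))].
apply/'forall_forallP => u v; apply/implyP => /proper_c; apply: contra.
rewrite !ffunE => /eqP/(congr1 val)/= eq_rank; apply/eqP.
by apply: enum_rank_in_inj (cS u) (cS v) (val_inj eq_rank).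
Qed.

Lemma chromatic_number_le (G : sgraph) k : (chromatic_number G <= k) = colorable G k.
Proof.
rewrite /chromatic_number; case: ex_minnP => m /existsP[c /'forall_forallP proper_c] min_m.
apply/idP/idP=> [mk|]; last exact: min_m.
apply: (@colorable_from _ _ setT c); rewrite ?cardsT ?card_ord // => u v uv.
by have /implyP/(_ uv) := proper_c u v.
Qed.

Lemma exists_vspace_coloring (G : sgraph) n (C : {vspace vec n}) :
  chromatic_number G <= 2 ^ \dim C ->
  exists2 c : G -> vec n,
    forall v, c v \in C & forall u v : G, adj u v -> c u != c v.
Proof.
rewrite chromatic_number_le -card_setv => /existsP[c /'forall_forallP proper_c].
exists (fun v => enum_val (c v)) => [v|u v uv].
  by have := enum_valP (c v); rewrite inE.
by rewrite (inj_eq enum_val_inj); have /implyP/(_ uv) := proper_c u v.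
Qed.

Lemma chromatic_number_del_edges (G : sgraph) (F : {set {set G}}) :
  chromatic_number (del_edges F) <= chromatic_number G.
Proof.
rewrite chromatic_number_le; have := leqnn (chromatic_number G).
rewrite {1}chromatic_number_le => /existsP[c proper_c]; apply/existsP; exists c.
apply/'forall_forallP => u v; apply/implyP => /andP[uv _].
by have /'forall_forallP/(_ u v)/implyP/(_ uv) := proper_c.
Qed.

(* The vertices are coloured by vectors of C; an edge goes to the sum of the colours
   of its ends plus a vector of U, which for the monochromatic edges, all in the
   forest F, can be prescribed to be in M. *)
Lemma restriction_of_forest_coloring (G : sgraph) n (M : {set vec n})
    (C U : {vspace vec n}) (F : {set {set G}}) :
  matroid M -> bose_burton M C U -> \dim U = #|G| ->
  forest F -> chromatic_number (del_edges F) <= 2 ^ \dim C ->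
  #|F| <= rank (M :&: setv U) -> has_restriction (graphic_matroid G) M.
Proof.
move=> M0 bbM dimU forestF /exists_vspace_coloring[c cC proper_c].
case/exists_free_seq=> s [free_s size_s sMU].
have [P PC Pc] := exists_linear_vertex_map cC.
have [|||||g [g_inj gU gF]] :=
    @exists_linear_bijection _ _ _ [seq incidence e | e <- enum F] s U.
- by rewrite dimv_vec.
- exact: forest_free.
- exact: free_s.
- by rewrite size_map -cardE.
- by move=> x /sMU; rewrite !inE => /andP[].
have P_in_C x : P x \in C by apply: (subvP PC); apply: memv_img; apply: memvf.
have g_in_U x : g x \in U by rewrite -gU; apply: memv_img; apply: memvf.
exists (P \+ g)%R; split=> [|].
  apply: raddf_inj => x /= /eqP; rewrite addr_eq0 oppr_F2 => /eqP Pg.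
  have gx0 : g x = 0%R.
    apply/eqP; rewrite -memv0 -(bose_burton_capv M0 bbM) memv_cap g_in_U andbT.
    by rewrite -Pg.
  by apply: (lker0P g_inj); rewrite gx0 linear0.
apply/subsetP => _ /imsetP[x + ->]; rewrite graphic_matroidE.
case/imsetP=> _ /edgesP[u [v [uv ->]]] -> /=.
have gM : [set u; v] \in F -> g (incidence [set u; v]) \in M.
  move=> eF; suff /sMU/setIP[] : g (incidence [set u; v]) \in s by [].
  by rewrite -gF; apply: map_f; apply: map_f; rewrite mem_enum.
have -> : P (incidence [set u; v]) = (c u + c v)%R.
  by rewrite incidence_pair ?adj_neq // linearD /= !Pc.
have [c_uv|c_uv] := eqVneq (c u) (c v).
  rewrite c_uv addrr_F2 add0r gM //; apply: contraT => uvF.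
  have /proper_c : @adj (del_edges F) u v by apply/andP.
  by rewrite c_uv eqxx.
by apply: bbM; rewrite ?memvD // addr_eq0 oppr_F2.
Qed.

(** * The extremal number *)

Section ExtremalNumber.
Variables (k n : nat) (N : {set vec k}).
Implicit Types (M : {set vec n}).

Lemma card_le_ex_number M : matroid M -> restriction_free N M -> #|M| <= ex_number N n.
Proof.
move=> M0 freeM; apply: (@leq_bigmax_cond _ _ (fun M : {set vec n} => #|M|)).
by rewrite M0; apply/asboolP.
Qed.

Lemma ex_number_attained M : matroid M -> restriction_free N M ->
  exists M', [/\ matroid M', restriction_free N M' & #|M'| = ex_number N n].
Proof.
move=> M0 freeM; pose P M' := matroid M' && `[< restriction_free N M' >].
have [|M' /andP[M'0 /asboolP freeM'] exM'] :=
    @eq_bigmax_cond _ P (fun M' : {set vec n} => #|M'|).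
  by apply/card_gt0P; exists M; rewrite unfold_in /P M0; apply/asboolP.
by exists M'; rewrite /ex_number -exM'.
Qed.

End ExtremalNumber.

Lemma card_setI_vspace_le_ex_number k m n (N : {set vec k}) (M : {set vec n})
    (H : {vspace vec n}) :
  matroid M -> restriction_free N M -> \dim H = m -> #|M :&: setv H| <= ex_number N m.
Proof.
move=> M0 freeM dimH.
have [|||||g [g_inj imgg _]] := @exists_linear_bijection _ (vec m) _ [::] [::] H;
  rewrite ?nil_free ?dimv_vec //.
have -> : M :&: setv H = g @: (g @^-1: M).
  apply/setP => y; rewrite inE in_setv -imgg; apply/andP/imsetP.
    by case=> yM /memv_imgP[x _ yE]; exists x; rewrite // inE -yE.
  by case=> x; rewrite inE => xM ->; rewrite memv_img ?memvf.
rewrite card_imset; last exact/lker0P.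
apply: card_le_ex_number; first by rewrite /matroid inE linear0.
case=> f [f_inj /subsetP fN]; apply: freeM; exists (g \o f)%R; split.
  by apply: inj_comp f_inj; apply/lker0P.
by apply/subsetP => _ /imsetP[x xN ->]; have := fN _ (imset_f f xN); rewrite inE.
Qed.

Lemma matroid_setC_vspace n (W : {vspace vec n}) : matroid (~: setv W).
Proof. by rewrite /matroid !inE mem0v. Qed.

Lemma chromatic_number_le_codim (G : sgraph) n (W : {vspace vec n}) :
  has_restriction (graphic_matroid G) (~: setv W) ->
  chromatic_number G <= 2 ^ (n - \dim W).
Proof.
case=> f [_ /subsetP fG]; pose p := daddv_pi (W^C) W.
have WC_W : (W^C :&: W)%VS = 0%VS by rewrite capvC capv_compl.
have p_eq0 x : p x = 0%R -> x \in W.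
  move=> px0; have x_sum : x \in (W^C + W)%VS by rewrite addvC addv_complf memvf.
  by rewrite -(daddv_pi_add WC_W x_sum) -/p px0 add0r memv_pi.
rewrite chromatic_number_le -[n in n - _]dimv_vec -dimv_compl.
apply: (@colorable_from _ _ (setv W^C) (fun v => p (f (incidence [set v])))).
- by move=> v; rewrite in_setv memv_pi.
- by rewrite card_setv.
move=> u v uv; have := fG _ (imset_f f (graphic_matroid_adj uv)); rewrite !inE raddfD /=.
by apply: contraNneq => p_uv; apply: p_eq0; rewrite linearD /= p_uv addrr_F2.
Qed.

Lemma density_ge_codimE (R : realFieldType) n (M : {set vec n}) t : t <= n ->
  (1 - 2 ^- t <= density fullv M :> R)%R = (2 ^ n <= #|M| + 2 ^ (n - t)).
Proof.
move=> tn; rewrite -(ler_nat R) natrD !natrX card_densityf.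
rewrite -[LHS](ler_pM2r (exp2_gt0 R n)) mulrBl mul1r lerBlDr; congr (_ <= _ + _)%R.
by rewrite -[n in LHS](subnK tn) exprD mulrC mulfK ?exp2_neq0.
Qed.

Lemma card_setCU_le n (M : {set vec n}) (W : {vspace vec n}) :
  2 ^ n <= #|M| + 2 ^ \dim W -> #|~: (M :|: setv W)| <= #|M :&: setv W|.
Proof.
have := cardsUI M (setv W); have := cardsC (M :|: setv W).
by rewrite card_vec card_setv; lia.
Qed.

Lemma card_lt_of_rank_lt n (M : {set vec n}) (W : {vspace vec n}) r :
  matroid M -> rank (M :&: setv W) < r ->
  #|M| + 2 ^ \dim W < 2 ^ n + 2 ^ (r - 1).
Proof.
move=> M0 rank_r; have := card_matroid_lt (matroid_setIl (setv W) M0).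
have : 2 ^ rank (M :&: setv W) <= 2 ^ (r - 1) by rewrite leq_exp2l //; lia.
have := cardsUI M (setv W); have := subset_leq_card (subsetT (M :|: setv W)).
by rewrite cardsT card_vec card_setv; lia.
Qed.

Lemma exists_hyperplane_card_setD_le n (M : {set vec n}) (W : {vspace vec n}) :
  rank (M :&: setv W) < \dim W ->
  exists2 H : {vspace vec n},
    \dim H = n.-1 & #|M :\: setv H| + 2 ^ (\dim W).-1 <= 2 ^ n.-1.
Proof.
move=> rank_lt; have [|H [spanH WH dimH]] := exists_hyperplane _ rank_lt.
  by apply/span_subvP => x; rewrite mem_enum !inE => /andP[].
rewrite dimv_vec in dimH; exists H => //.
have W_gt0 : 0 < \dim W by lia.
have Wn : \dim W <= n by rewrite -[leqRHS]dimv_vec dimvS ?subvf.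
have dimWH : \dim (W :&: H) = (\dim W).-1.
  by have := dimv_sum_cap W H; rewrite WH dimv_vec dimH; lia.
have MH : #|M :\: setv H| <= #|~: (setv W :|: setv H)|.
  apply/subset_leq_card/subsetP => x; rewrite !inE negb_or => /andP[xH xM].
  rewrite xH andbT; apply: contra xH => xW; apply: (subvP spanH).
  by apply: memv_span; rewrite mem_enum !inE xM.
have := cardsC (setv W :|: setv H); have := cardsUI (setv W) (setv H).
rewrite -setvI !card_setv dimWH dimH card_vec.
have : 2 ^ \dim W = 2 * 2 ^ (\dim W).-1 by rewrite -expnS prednK.
have : 2 ^ n = 2 * 2 ^ n.-1 by rewrite -expnS prednK //; lia.
by move: MH; lia.
Qed.

Lemma exists_low_rank_codim (G : sgraph) t (F : {set {set G}}) :
  chromatic_number G <= 2 ^ t.+1 -> forest F -> chromatic_number (del_edges F) <= 2 ^ t ->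
  exists n0, forall n (M : {set vec n}), n0 <= n ->
    matroid M -> restriction_free (graphic_matroid G) M -> 2 ^ n <= #|M| + 2 ^ (n - t) ->
    exists2 W : {vspace vec n}, \dim W + t = n & rank (M :&: setv W) < #|F|.
Proof.
move=> chiG forestF chiGF; pose k := #|G|; pose eps : rat := (2 ^- (t + k).+1)%R.
have [|n0 stab] := @stability rat t k eps; first exact: exp2V_gt0.
exists (n0 + t + k) => n M nn M0 freeM cardM.
have [|||W dimW densW] := stab n M _ M0.
- by lia.
- by rewrite density_ge_codimE //; lia.
- move=> C W dimC dimW bbM; apply: freeM.
  apply: (restriction_of_forest_coloring M0 bbM dimW (forest0 G)); last by rewrite cards0.
  by rewrite dimC (leq_trans (chromatic_number_del_edges _)).
exists W => //; rewrite ltnNge; apply/negP => rankF.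
have [|U [UW dimU rankU]] := exists_vspace_rank (k := k) rankF.
  by rewrite card_forest_le //; lia.
have [||C dimC bbM] := exists_bose_burton (t := t) (M := M) UW; first by rewrite dimW.
  rewrite dimU; apply: leq_trans (leq_mul (leqnn _) (card_setCU_le _)) _.
    by rewrite -[\dim W](addnK t) dimW.
  rewrite -(ler_nat rat) natrM !natrX card_densityf mulrA ler_piMl ?(ltW (exp2_gt0 _ _)) //.
  by rewrite mulrC -ler_pdivlMr ?exp2_gt0 // mul1r.
by apply: freeM; apply: (restriction_of_forest_coloring M0 bbM dimU forestF); rewrite ?dimC.
Qed.

Section Excess.
Variables (G : sgraph) (t : nat).
Hypothesis chi_gt : 2 ^ t < chromatic_number G.
Local Notation exG := (ex_number (graphic_matroid G)).

(* For t <= n the truncated subtraction is exact, by ex_number_excess. *)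
Definition excess n : nat := exG n - (2 ^ n - 2 ^ (n - t)).

Lemma exists_vspace_codim n : t <= n -> exists W : {vspace vec n}, \dim W + t = n.
Proof.
move=> tn; have [|W _ dimW] := @exists_subv_dim _ (vec n) fullv (n - t).
  by rewrite dimv_vec leq_subr.
by exists W; rewrite dimW subnK.
Qed.

Lemma vspaceC_restriction_free n (W : {vspace vec n}) :
  \dim W + t = n -> restriction_free (graphic_matroid G) (~: setv W).
Proof.
move=> dimW /chromatic_number_le_codim; apply/negP; rewrite -ltnNge.
by rewrite -[n in n - _]dimW addKn.
Qed.

Lemma ex_number_excess n : t <= n -> exG n + 2 ^ (n - t) = 2 ^ n + excess n.
Proof.
move=> tn; have [W dimW] := exists_vspace_codim tn.
have := card_le_ex_number (matroid_setC_vspace W) (vspaceC_restriction_free dimW).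
have := cardsC (setv W); rewrite card_vec card_setv /excess.
by rewrite -[X in 2 ^ (X - t)]dimW addnK; lia.
Qed.

Variable F : {set {set G}}.
Hypotheses (chi_le : chromatic_number G <= 2 ^ t.+1) (forestF : forest F).
Hypothesis chi_delF : chromatic_number (del_edges F) <= 2 ^ t.

Lemma exists_extremal_matroid : exists n0, forall n, n0 <= n ->
  exists (M : {set vec n}) (W : {vspace vec n}),
    [/\ matroid M, restriction_free (graphic_matroid G) M, #|M| = exG n,
        \dim W + t = n & rank (M :&: setv W) < #|F|].
Proof.
have [n0 structure] := exists_low_rank_codim chi_le forestF chi_delF.
exists (n0 + t) => n nn; have tn : t <= n by lia.
have [W0 dimW0] := exists_vspace_codim tn.
have [M [M0 freeM cardM]] :=
  ex_number_attained (matroid_setC_vspace W0) (vspaceC_restriction_free dimW0).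
have [||W dimW rankW] := structure n M _ M0 freeM; first by lia.
  by rewrite cardM ex_number_excess // leq_addr.
by exists M, W.
Qed.

Lemma excess_lt : exists n0, forall n, n0 <= n -> excess n < 2 ^ (#|F| - 1).
Proof.
have [n0 extremal] := exists_extremal_matroid; exists n0 => n nn.
have [M [W [M0 _ cardM dimW rankW]]] := extremal n nn.
have := card_lt_of_rank_lt M0 rankW; rewrite cardM -[\dim W](addnK t) dimW.
by rewrite ex_number_excess ?ltn_add2l // -dimW leq_addl.
Qed.

Lemma excess_nonincreasing : exists n0, forall n, n0 <= n -> excess n.+1 <= excess n.
Proof.
have [n0 extremal] := exists_extremal_matroid; exists (n0 + t + #|F|) => n nn.
have [|M [W [M0 freeM cardM dimW rankW]]] := extremal n.+1; first by lia.
have [|H dimH cardMH] := @exists_hyperplane_card_setD_le _ M W; first by lia.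
have sectionM : #|M :&: setv H| <= exG n.
  exact: card_setI_vspace_le_ex_number M0 freeM dimH.
have := cardsID (setv H) M; rewrite cardM.
have dimW' : (\dim W).-1 = n - t by lia.
have tn : t <= n by lia.
have := ex_number_excess (leqW tn); have := ex_number_excess tn.
move: cardMH sectionM; rewrite dimW' /= subSn // !expnS.
by move: #|_ :&: _| #|_ :\: _|; lia.
Qed.

End Excess.

Lemma eventually_nonincreasing_constant (u : nat -> nat) :
  (exists n0, forall n, n0 <= n -> u n.+1 <= u n) ->
  exists l n0, forall n, n0 <= n -> u n = l.
Proof.
case=> n0 dec_u; have attained : exists l, `[< exists2 n, n0 <= n & u n = l >].
  by exists (u n0); apply/asboolP; exists n0.
case: (ex_minnP attained) => l /asboolP[n1 n01 <-] min_l; exists (u n1), n1 => n n1n.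
apply/eqP; rewrite eqn_leq min_l ?andbT; last first.
  by apply/asboolP; exists n => //; apply: leq_trans n1n.
elim: n n1n => [|n IHn]; first by rewrite leqn0 => /eqP->.
rewrite leq_eqVlt => /orP[/eqP->//|n1n].
exact: leq_trans (dec_u _ (leq_trans n01 n1n)) (IHn n1n).
Qed.

Theorem theorem1p5 (G : sgraph) (t : nat) :
  2 <= chromatic_number G ->
  2 ^ t < chromatic_number G <= 2 ^ t.+1 ->
  exists l : int, forall F : {set {set G}},
    forest F ->
    chromatic_number (del_edges F) <= 2 ^ t ->
    (l < 2 ^+ (#|F| - 1))%R /\
    exists n0 : nat, forall n : nat, n0 <= n ->
      ((ex_number (graphic_matroid G) n)%:R
        = 2 ^+ n * (1 - 2 ^- t) + l%:~R :> rat)%R.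
Proof.
move=> _ /andP[chi_gt chi_le].
have [[F0 forestF0 chiF0]|noF] :=
  pselect (exists2 F : {set {set G}}, forest F & chromatic_number (del_edges F) <= 2 ^ t);
  last by exists 0%R => F forestF chiF; case: noF; exists F.
have [l [n1 excess_eq]] := eventually_nonincreasing_constant
  (excess_nonincreasing chi_gt chi_le forestF0 chiF0).
exists (Posz l) => F forestF chiF; split.
  have [n2 excess_ltF] := excess_lt chi_gt chi_le forestF chiF.
  have := excess_ltF _ (leq_maxr n1 n2); rewrite excess_eq ?leq_maxl //.
  by rewrite -(@natrX int 2) -natz ltr_nat.
exists (maxn n1 t) => n; rewrite geq_max => /andP[n1n tn].
apply: (addIr (2 ^+ (n - t))%R); rewrite -natrX -natrD ex_number_excess //.
rewrite excess_eq // natrD natrX natrX mulrBr mulr1 addrAC.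
by rewrite -[n in (2 ^+ n * _)%R](subnK tn) exprD mulfK ?exp2_neq0 // subrK.
Qed.
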